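(* The equilibrium points of the dynamical system $y'(t)=V(y(t))$ on $\mathcal{P}(\mathcal{X})$ (that is, the $y\in\mathcal{P}(\mathcal{X})$ with $V(y)=0$) are exactly the probability distributions $\nu_\rho$ on $\mathcal{X}$, $$\nu_\rho(n)=\frac{1}{Z(\rho)}\prod_{\ell=1}^{K}\frac{\rho_\ell^{n_\ell}}{n_\ell!},\qquad n=(n_\ell)\in\mathcal{X},\qquad\text{where } Z(\rho)=\sum_{m\in\mathcal{X}}\prod_{\ell=1}^{K}\frac{\rho_\ell^{m_\ell}}{m_\ell!},$$ and $\rho=(\rho_k,1\le k\le K)$ is a vector of $\mathbb{R}_+^K$ satisfying the system of equations $$\lambda_k=\rho_k\left(\mu_k+\gamma_k\,\frac{\sum_{n\in\mathcal{X}:\,n+f_k\notin\mathcal{X}}\ \prod_{\ell=1}^{K}\rho_\ell^{n_\ell}/n_\ell!}{\sum_{n\in\mathcal{X}}\ \prod_{\ell=1}^{K}\rho_\ell^{n_\ell}/n_\ell!}\right),\qquad 1\le k\le K.$$ There always exists at least one equilibrium point.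
   Context: Fix integers $K\ge1$, $C\ge1$, positive integers $A_1,\dots,A_K$ and rates $\lambda_k>0$, $\gamma_k>0$, $\mu_k\ge0$ for $1\le k\le K$. Let $f_k$ be the $k$th unit vector of $\mathbb{R}^K$, let $$\mathcal{X}=\{n=(n_k)\in\mathbb{N}^K: A_1n_1+\cdots+A_Kn_K\le C\}\quad(\mathbb{N}=\{0,1,2,\dots\}),$$ and let $\mathcal{P}(\mathcal{X})$ be the set of probability distributions $y=(y_n)_{n\in\mathcal{X}}$ on $\mathcal{X}$. Write $\mathbb{R}_+=[0,\infty)$ and $\langle\mathbb{I}_k,y\rangle=\sum_{m\in\mathcal{X}}m_ky_m$. The vector field $V(y)=(V_n(y),\,n\in\mathcal{X})$ is $$V_n(y)=\sum_{k=1}^{K}(\lambda_k+\gamma_k\langle\mathbb{I}_k,y\rangle)\left(y_{n-f_k}\mathbf{1}_{\{n_k\ge1\}}-y_n\mathbf{1}_{\{n+f_k\in\mathcal{X}\}}\right)+\sum_{k=1}^{K}(\gamma_k+\mu_k)\left((n_k+1)y_{n+f_k}\mathbf{1}_{\{n+f_k\in\mathcal{X}\}}-n_ky_n\right),$$ where terms multiplied by a zero indicator are $0$. *)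

(* Defs.v *)
From HB Require Import structures.
From mathcomp Require Import all_boot all_order all_algebra.
From mathcomp Require Import reals.

Set Implicit Arguments.
Unset Strict Implicit.
Unset Printing Implicit Defensive.

Import Order.TTheory GRing.Theory Num.Theory.

Local Open Scope ring_scope.

Section StateSpace.
Variables (K C : nat) (A : 'I_K -> nat).

Definition fits (m : 'I_K -> nat) : bool := (\sum_(k < K) A k * m k <= C)%N.

(* The set X, as a finite type.  Coordinates are stored in {0, ..., C}; for
   positive A_k this is no restriction (see [state_of_fits]). *)
Record state := State {
  state_val : {ffun 'I_K -> 'I_C.+1};
  _ : fits (fun k => state_val k)
}.

HB.instance Definition _ := [isSub for state_val].
HB.instance Definition _ := [Finite of state by <:].

Definition occ (n : state) : 'I_K -> nat := fun k => state_val n k.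
Coercion occ : state >-> Funclass.

Lemma fits_state (n : state) : fits n.
Proof. by case: n. Qed.

Lemma occ_inj (n n' : state) : n =1 n' -> n = n'.
Proof.
by move=> e; apply/val_inj/ffunP => k; apply/val_inj; exact: (e k).
Qed.

Lemma state_of_fits (m : 'I_K -> nat) :
  (forall k, 0 < A k)%N -> fits m -> exists n : state, n =1 m.
Proof.
move=> A_gt0 fm; have mC k : (m k < C.+1)%N.
  rewrite ltnS; apply: leq_trans fm; rewrite (bigD1 k) //=.
  by apply: leq_trans (leq_addr _ _); rewrite leq_pmull.
pose v := [ffun k => Ordinal (mC k)].
have fv : fits (fun k => v k).
  by rewrite /fits (eq_bigr (fun k => A k * m k)%N) // => k _; rewrite ffunE.
by exists (State fv) => k; rewrite /occ /= ffunE.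
Qed.

End StateSpace.

(* n + f_k, and n - f_k (the latter only meaningful when n k >= 1). *)
Definition incr K (m : 'I_K -> nat) (k : 'I_K) : 'I_K -> nat :=
  fun l => (m l + (l == k))%N.
Definition decr K (m : 'I_K -> nat) (k : 'I_K) : 'I_K -> nat :=
  fun l => (m l - (l == k))%N.

Section Dynamics.
Variables (R : realType) (K C : nat) (A : 'I_K -> nat).
Variables (lambda gamma mu : 'I_K -> R).

Local Notation X := (state C A).

Definition is_distr (y : {ffun X -> R}) : Prop :=
  (forall n, 0 <= y n) /\ \sum_n y n = 1.

(* y_m for an arbitrary multi-index m, with value 0 when m is not in X. *)
Definition coef (y : {ffun X -> R}) (m : 'I_K -> nat) : R :=
  if [pick n : X | [forall k, n k == m k]] is Some n then y n else 0.

Definition mean (k : 'I_K) (y : {ffun X -> R}) : R :=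
  \sum_(m : X) (m k)%:R * y m.

Definition V (y : {ffun X -> R}) : {ffun X -> R} := [ffun n : X =>
  \sum_(k < K) (lambda k + gamma k * mean k y) *
    ((if (1 <= n k)%N then coef y (decr n k) else 0)
     - (if fits C A (incr n k) then y n else 0))
  + \sum_(k < K) (gamma k + mu k) *
    ((if fits C A (incr n k) then (n k).+1%:R * coef y (incr n k) else 0)
     - (n k)%:R * y n)].

Definition equilibrium (y : {ffun X -> R}) : Prop :=
  is_distr y /\ V y = 0.

Definition weight (rho : 'I_K -> R) (n : X) : R :=
  \prod_(l < K) (rho l ^+ n l / ((n l)`!)%:R).

Definition Z (rho : 'I_K -> R) : R := \sum_(m : X) weight rho m.

Definition nu (rho : 'I_K -> R) : {ffun X -> R} :=
  [ffun n => (Z rho)^-1 * weight rho n].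

Definition rho_system (rho : 'I_K -> R) : Prop :=
  forall k, lambda k =
    rho k * (mu k + gamma k *
      ((\sum_(n : X | ~~ fits C A (incr n k)) weight rho n)
       / (\sum_(n : X) weight rho n))).

End Dynamics.

Arguments nu {R K} C A rho.

(* Main.v *)
Require Import Defs.
From HB Require Import structures.
From mathcomp Require Import all_boot all_order all_algebra.
From mathcomp Require Import all_classical reals topology normedtype.
From mathcomp Require Import sequences derive realfun exp.
From mathcomp Require Import ring lra.

(** Fix [y] and put [a_k = lambda_k + gamma_k <I_k, y>], [b_k = gamma_k + mu_k].
   Then [V y = 0] says that [y] is invariant for the multiclass Erlang loss
   process with arrival rates [a_k] and departure rates [b_k]. That process is
   reversible and irreducible, with invariant distribution [nu_rho] for
   [rho_k = a_k / b_k]; uniqueness comes from the Dirichlet form of [y / nu_rho]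
   ([sum_V], [equilibrium_nu]). So the equilibria are the [nu_rho] with
   [lambda_k + gamma_k <I_k, nu_rho> = rho_k (gamma_k + mu_k)], and the identity
   [<I_k, nu_rho> = rho_k (1 - blocking probability)] of [mean_nu] turns this
   into the stated system ([rho_systemP]).

   Existence is variational and needs no topological fixed point theorem. Since
   [<I_k, nu_rho> = rho_k d(ln Z)/d(rho_k)], the equations say that [rho] is a
   critical point of
     [sum_k ((gamma_k + mu_k) / gamma_k * rho_k - lambda_k / gamma_k * ln rho_k)
      - ln Z(rho)].
   The map sending [rho] to [a_k / b_k], with [y = nu_rho], has values in a
   compact box and makes this function decrease, strictly unless [rho] is a
   fixed point; this follows from convexity of [ln Z] in [ln rho]
   ([ln_Z_tangent], [potential_update]). A minimiser over the box is therefore a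
   fixed point ([fixed_point_exists]). *)

Import Order.TTheory GRing.Theory Num.Theory.
Import numFieldNormedType.Exports.

Local Open Scope ring_scope.

Set Implicit Arguments.
Unset Strict Implicit.
Unset Printing Implicit Defensive.

(** * Moves between neighbouring states *)

Section Moves.
Variables (K C : nat) (A : 'I_K -> nat).
Hypothesis A_gt0 : forall k, (0 < A k)%N.
Local Notation X := (state C A).
Implicit Types (n : X) (k l : 'I_K) (m : 'I_K -> nat).

(** A total choice of state makes the moves ordinary functions [X -> X], usable
   in sums; the default [n] is returned only for [m] outside the state space. *)
Definition locate n m : X := odflt n [pick p : X | [forall l, p l == m l]].

Lemma locateE n m : fits C A m -> locate n m =1 m.
Proof.
move=> /(state_of_fits A_gt0)[p pm]; rewrite /locate.
case: pickP => [q /forallP qm l|/(_ p)/forallP[] l]; first exact/eqP.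
exact/eqP.
Qed.

Definition up n k : X := locate n (incr n k).
Definition down n k : X := locate n (decr n k).

Lemma fits_le m (p : X) : (forall l, m l <= p l)%N -> fits C A m.
Proof.
move=> le_mp; apply: leq_trans (fits_state p).
by apply: leq_sum => l _; rewrite leq_mul2l le_mp orbT.
Qed.

Lemma upE n k : fits C A (incr n k) -> up n k =1 incr n k.
Proof. exact: locateE. Qed.

Lemma downE n k : down n k =1 decr n k.
Proof.
by apply: locateE; apply: (@fits_le _ n) => l; rewrite leq_subr.
Qed.

Lemma up_pos n k : fits C A (incr n k) -> (0 < up n k k)%N.
Proof. by move=> fn; rewrite upE // /incr eqxx addn1. Qed.

Lemma downK n k : (0 < n k)%N ->
  fits C A (incr (down n k) k) && (up (down n k) k == n).
Proof.
move=> n_gt0.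
have e : incr (down n k) k =1 n.
  move=> l; rewrite /incr downE /decr; have [->|_] := eqVneq l k.
    by rewrite subnK.
  by rewrite subn0 addn0.
have fn : fits C A (incr (down n k) k).
  by apply: (@fits_le _ n) => l; rewrite e.
by rewrite fn; apply/eqP/occ_inj => l; rewrite upE.
Qed.

Lemma upK n k : fits C A (incr n k) -> down (up n k) k = n.
Proof.
by move=> fn; apply: occ_inj => l; rewrite downE /decr upE // /incr addnK.
Qed.

(** The moves [n |-> n + f_k] and [n |-> n - f_k] are inverse bijections between
   the states with room for [f_k] and those with a class [k] customer. *)
Lemma sum_up (R : nmodType) k (F : X -> R) :
  \sum_(n : X | (0 < n k)%N) F n = \sum_(n : X | fits C A (incr n k)) F (up n k).
Proof.
rewrite (reindex_onto (up^~ k) (down^~ k)) /=; last first.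
  by move=> n /downK/andP[_ /eqP].
apply: eq_bigl => n; apply/andP/idP => [[up_gt0 /eqP e]|fn].
  by have /andP[] := downK up_gt0; rewrite e.
by rewrite up_pos // upK.
Qed.

Lemma fits0 : fits C A (fun=> 0%N).
Proof. by rewrite /fits big1 // => k _; rewrite muln0. Qed.

(** Irreducibility: induction on the total number of customers reaches every
   state from the empty one. *)
Lemma up_ind (P : X -> Prop) :
  (forall n, n =1 (fun=> 0%N) -> P n) ->
  (forall n k, fits C A (incr n k) -> P n -> P (up n k)) ->
  forall n, P n.
Proof.
move=> P0 Pup n; have [s] := ubnP (\sum_k n k)%N.
elim: s n => // s IH n; rewrite ltnS => le_s.
have [/existsP[k n_gt0]|none] := boolP [exists k, 0 < n k]%N; last first.
  apply: P0 => k; apply/eqP; rewrite -leqn0 leqNgt.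
  by move: none; rewrite negb_exists => /forallP.
have /andP[fdn /eqP <-] := downK n_gt0; apply: Pup => //; apply: IH.
apply: leq_trans le_s; rewrite (bigD1 k) // [X in (_ < X)%N](bigD1 k) //= -addSn.
rewrite downE /decr eqxx; apply: leq_add; first by rewrite subn1 prednK.
by apply: leq_sum => l _; rewrite downE leq_subr.
Qed.

End Moves.

(** * Flows, detailed balance and equilibria *)

Section Flux.
Variables (R : realType) (K C : nat) (A : 'I_K -> nat).
Hypothesis A_gt0 : forall k, (0 < A k)%N.
Local Notation X := (state C A).
Implicit Types (y : {ffun X -> R}) (n : X) (k : 'I_K) (rho : 'I_K -> R).

Lemma coef_locate y n m : fits C A m -> coef y m = y (locate n m).
Proof.
move=> fm; rewrite /coef; case: pickP => [p /forallP pm|].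
  by congr (y _); apply: occ_inj => l; rewrite locateE //; exact/eqP.
by have [p pm] := state_of_fits A_gt0 fm; move=> /(_ p)/forallP[] l; apply/eqP.
Qed.

(** The net probability flow along the edge from [n] to [n + f_k], for arrival
   rates [lam] and departure rates [mu] per customer. *)
Definition flux (lam mu : 'I_K -> R) y k n : R :=
  lam k * y n - mu k * (n k).+1%:R * y (up n k).

Section Fixed.
Variables lambda gamma mu : 'I_K -> R.
Let arrival y k := lambda k + gamma k * mean k y.
Let departure k := gamma k + mu k.
Local Notation flow y := (flux (arrival y) departure y).

(** With the means inside the arrival rates treated as given numbers, [V] is the
   forward equation of a birth and death process: the drift at [n] is what
   comes from the edges below minus what leaves through the edges above. *)
Lemma V_flux y n : V lambda gamma mu y n =
  \sum_k ((if (0 < n k)%N then flow y k (down n k) else 0)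
          - (if fits C A (incr n k) then flow y k n else 0)).
Proof.
rewrite ffunE -big_split; apply: eq_bigr => k _ /=.
rewrite /flux -/(arrival y k) -/(departure k).
have -> : (if fits C A (incr n k) then (n k).+1%:R * coef y (incr n k) else 0)
        = (if fits C A (incr n k) then (n k).+1%:R * y (up n k) else 0).
  by case: ifP => // fn; rewrite (coef_locate _ n).
case: (ltnP 0 (n k)) => [n_gt0|]; last first.
  by rewrite leqn0 => /eqP ->; case: ifP => _; ring.
have -> : coef y (decr n k) = y (down n k).
  by apply: coef_locate; apply: (@fits_le _ _ _ _ n) => l; apply: leq_subr.
have /andP[_ /eqP ->] := downK A_gt0 n_gt0.
rewrite downE // /decr eqxx subn1 prednK //.
by case: ifP => _; ring.
Qed.

(** Summation by parts: each edge contributes its flow at both of its ends, with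
   opposite signs. *)
Lemma sum_V y (h : X -> R) : \sum_n h n * V lambda gamma mu y n =
  \sum_k \sum_(n : X | fits C A (incr n k)) (h (up n k) - h n) * flow y k n.
Proof.
under eq_bigr do rewrite V_flux mulr_sumr.
rewrite exchange_big /=; apply: eq_bigr => k _.
under eq_bigr do rewrite mulrBr.
rewrite big_split /= sumrN.
have -> : \sum_(n : X) h n * (if (0 < n k)%N then flow y k (down n k) else 0)
   = \sum_(n : X | (0 < n k)%N) h n * flow y k (down n k).
  by rewrite [RHS]big_mkcond; apply: eq_bigr => n _; case: ifP; rewrite ?mulr0.
have -> : \sum_(n : X) h n * (if fits C A (incr n k) then flow y k n else 0)
   = \sum_(n : X | fits C A (incr n k)) h n * flow y k n.
  by rewrite [RHS]big_mkcond; apply: eq_bigr => n _; case: ifP; rewrite ?mulr0.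
rewrite sum_up // -sumrB; apply: eq_bigr => n fn.
by rewrite upK // mulrBl.
Qed.

End Fixed.

Section Weight.
Variable rho : 'I_K -> R.

(** Detailed balance: [weight rho] makes every edge carry no net flow for
   arrival rates [rho] and unit departure rates. *)
Lemma weight_up n k : fits C A (incr n k) ->
  (n k).+1%:R * weight rho (up n k) = rho k * weight rho n.
Proof.
move=> fn; rewrite /weight (bigD1 k) // [in RHS](bigD1 k) //= !mulrA.
rewrite upE // {1 2}/incr eqxx addn1; congr (_ * _); last first.
  by apply: eq_bigr => l /negbTE ne; rewrite upE // /incr ne addn0.
rewrite factS natrM exprS; field.
by rewrite nat1r !pnatr_eq0 -lt0n fact_gt0.
Qed.

Hypothesis rho_ge0 : forall k, 0 <= rho k.

Lemma weight_ge0 n : 0 <= weight rho n.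
Proof. by apply: prodr_ge0 => k _; rewrite divr_ge0 ?exprn_ge0. Qed.

Lemma weight_gt0 n : (forall k, 0 < rho k) -> 0 < weight rho n.
Proof.
move=> rho_gt0; apply: prodr_gt0 => k _.
by rewrite divr_gt0 ?exprn_gt0 // ltr0n fact_gt0.
Qed.

Lemma Z_gt0 : 0 < Z C A rho.
Proof.
have [o o0] := state_of_fits A_gt0 (fits0 C A).
rewrite /Z (bigD1 o) //= ltr_pwDl ?sumr_ge0 // => [|*]; last exact: weight_ge0.
by rewrite /weight big1 // => k _; rewrite o0 expr0 fact0 divr1.
Qed.

Lemma nu_distr : is_distr (nu C A rho).
Proof.
split=> [n|]; first by rewrite ffunE mulr_ge0 ?invr_ge0 ?weight_ge0 ?ltW ?Z_gt0.
under eq_bigr do rewrite ffunE.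
by rewrite -mulr_sumr mulVf ?gt_eqF ?Z_gt0.
Qed.

(** Summing detailed balance over the edges of class [k]: the mean number of
   customers is the load [rho k] times the acceptance probability. *)
Lemma mean_nu k : mean k (nu C A rho) = rho k * (1 -
  (\sum_(n : X | ~~ fits C A (incr n k)) weight rho n)
   / (\sum_(n : X) weight rho n)).
Proof.
have Z0 : Z C A rho != 0 by rewrite gt_eqF ?Z_gt0.
apply: (mulfI Z0).
have -> : Z C A rho * mean k (nu C A rho) =
    \sum_(n : X | (0 < n k)%N) (n k)%:R * weight rho n.
  rewrite /mean mulr_sumr [RHS]big_mkcond; apply: eq_bigr => n _; rewrite ffunE.
  case: ltnP => [_|]; first by field.
  by rewrite leqn0 => /eqP ->; rewrite !mul0r mulr0.
rewrite sum_up //.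
under eq_bigr => n fn do rewrite upE // /incr eqxx addn1 weight_up //.
rewrite -mulr_sumr mulrCA mulrBr mulr1 mulrCA divff // mulr1.
by rewrite {1}/Z [in RHS](bigID (fun n : X => fits C A (incr n k))) addrK.
Qed.

(** By [mean_nu] the system asks that [rho k] be the ratio between the arrival
   rate produced by [nu rho] itself and the departure rate. *)
Lemma rho_systemP (lambda gamma mu : 'I_K -> R) :
  rho_system C A lambda gamma mu rho <->
  forall k, lambda k + gamma k * mean k (nu C A rho) = rho k * (gamma k + mu k).
Proof. by split=> H k; have := H k; rewrite mean_nu; set b := _ / _; lra. Qed.

End Weight.

Section Equilibrium.
Variables lambda gamma mu : 'I_K -> R.

(** The flow vanishes along each edge, hence so does the drift at each state. *)
Lemma nu_equilibrium rho : (forall k, 0 <= rho k) ->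
  rho_system C A lambda gamma mu rho -> equilibrium lambda gamma mu (nu C A rho).
Proof.
move=> rho_ge0 /(rho_systemP rho_ge0) rhoP; split; first exact: nu_distr.
have flux0 k (n : X) : fits C A (incr n k) ->
    flux (fun k => lambda k + gamma k * mean k (nu C A rho))
         (fun k => gamma k + mu k) (nu C A rho) k n = 0.
  move=> fn; rewrite /flux rhoP !ffunE.
  transitivity ((gamma k + mu k) * (Z C A rho)^-1
    * (rho k * weight rho n - (n k).+1%:R * weight rho (up n k))); first by ring.
  by rewrite weight_up // subrr mulr0.
apply/ffunP => n; rewrite V_flux // [RHS]ffunE big1 // => k _.
rewrite [X in _ - X](_ : _ = 0); last by case: ifP => // /flux0.
by case: ifP => [/(downK A_gt0)/andP[/flux0 ->]|]; rewrite subr0.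
Qed.

(** For [rho] read off from [y], the density [h = y / weight rho] satisfies
   [flux y k n = - a k * weight rho n * (h (n + f_k) - h n)]. Testing [V y = 0]
   against [h] shows that the Dirichlet form of [h] vanishes; [h] is then
   constant along edges, hence constant, and [y = nu rho]. *)
Lemma equilibrium_nu y :
  (forall k, 0 < lambda k) -> (forall k, 0 < gamma k) -> (forall k, 0 <= mu k) ->
  equilibrium lambda gamma mu y ->
  exists rho, [/\ forall k, 0 <= rho k, rho_system C A lambda gamma mu rho
                & y = nu C A rho].
Proof.
move=> lam_gt0 gam_gt0 mu_ge0 [[y_ge0 y1] V0].
pose a k := lambda k + gamma k * mean k y.
pose b k := gamma k + mu k.
have a_gt0 k : 0 < a k.
  rewrite ltr_pwDl // mulr_ge0 ?sumr_ge0 ?ltW // => n _.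
  by rewrite mulr_ge0.
have b_gt0 k : 0 < b k by rewrite ltr_pwDl.
pose rho k := a k / b k.
have rho_gt0 k : 0 < rho k by rewrite divr_gt0.
have rho_ge0 k : 0 <= rho k by rewrite ltW.
have w_gt0 n := @weight_gt0 rho n rho_gt0.
pose h n := y n / weight rho n.
have yh n : y n = h n * weight rho n by rewrite divfK ?gt_eqF.
have flux_h k n : fits C A (incr n k) ->
    flux a b y k n = - (a k * weight rho n * (h (up n k) - h n)).
  move=> fn; rewrite /flux [y n]yh [y _]yh.
  have -> : a k = b k * rho k by rewrite mulrC divfK ?gt_eqF.
  transitivity (b k * (h n * (rho k * weight rho n)
      - h (up n k) * ((n k).+1%:R * weight rho (up n k)))); first by ring.
  by rewrite weight_up //; ring.
have dirichlet0 :
    \sum_k \sum_(n : X | fits C A (incr n k))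
       a k * weight rho n * (h (up n k) - h n) ^+ 2 = 0.
  apply: oppr_inj; rewrite oppr0 -sumrN.
  transitivity (\sum_n h n * V lambda gamma mu y n).
    rewrite sum_V; apply: eq_bigr => k _; rewrite -sumrN.
    by apply: eq_bigr => n fn; rewrite flux_h //; ring.
  by rewrite V0 big1 // => n _; rewrite ffunE mulr0.
have h_up k n : fits C A (incr n k) -> h (up n k) = h n.
  have term_ge0 l (p : X) : 0 <= a l * weight rho p * (h (up p l) - h p) ^+ 2.
    by rewrite mulr_ge0 ?sqr_ge0 ?mulr_ge0 ?ltW.
  move=> fn; apply/eqP; rewrite -subr_eq0 -sqrf_eq0.
  have row0 := psumr_eq0P (fun l _ => sumr_ge0 _ (fun p _ => term_ge0 l p))
    dirichlet0 (i := k) isT.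
  have /eqP := psumr_eq0P (fun p _ => term_ge0 k p) row0 (i := n) fn.
  by rewrite mulf_eq0 gt_eqF ?mulr_gt0.
have [o o0] := state_of_fits A_gt0 (fits0 C A).
have h_const n : h n = h o.
  apply: (up_ind A_gt0 (P := fun n => h n = h o)) => [{}n n0|{}n k fn <-];
    last exact: h_up.
  by congr h; apply: occ_inj => l; rewrite n0 o0.
have y_nu : y = nu C A rho.
  have hZ : h o * Z C A rho = 1.
    by rewrite -y1 mulr_sumr; apply: eq_bigr => n _; rewrite [in RHS]yh h_const.
  apply/ffunP => n; rewrite ffunE yh h_const; congr (_ * _).
  by apply: (mulIf (lt0r_neq0 (Z_gt0 rho_ge0))); rewrite hZ mulVf ?gt_eqF ?Z_gt0.
exists rho; split=> //; apply/(rho_systemP rho_ge0) => k.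
by rewrite -y_nu divfK ?gt_eqF.
Qed.

End Equilibrium.
End Flux.

(** * Existence by minimisation *)

(** The tangent line of the exponential at the mean [t] of [s] lies below its
   graph, and averages to [expR t]. *)
Lemma expR_jensen (R : realType) (T : finType) (p s : T -> R) :
  (forall i, 0 <= p i) -> \sum_i p i = 1 ->
  expR (\sum_i p i * s i) <= \sum_i p i * expR (s i).
Proof.
move=> p_ge0 p1; set t := \sum_i _.
have -> : expR t = \sum_i p i * (expR t * (1 + (s i - t))).
  transitivity (expR t * \sum_i (p i + (p i * s i - p i * t))).
    by rewrite big_split sumrB -/t -mulr_suml p1 /=; ring.
  by rewrite mulr_sumr; apply: eq_bigr => i _; ring.
apply: ler_sum => i _; apply: ler_wpM2l => //.
rewrite -[in leRHS](subrKC t (s i)) expRD.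
by rewrite ler_wpM2l ?expR_ge0 ?expR_ge1Dx.
Qed.

(** With [u = ln (x / z)], this is [1 + u <= expR u] scaled by [z]. The equality
   case is what makes a minimiser of [potential] below a fixed point. *)
Lemma entropy_gap (R : realType) (x z : R) : 0 < x -> 0 < z ->
  0 <= x - z - z * (ln x - ln z) ?= iff (x == z).
Proof.
move=> x0 z0; rewrite -ln_div ?posrE //; set u := ln _.
have -> : x = z * expR u by rewrite lnK ?posrE ?divr_gt0 // mulrC divfK ?gt_eqF.
have -> : z * expR u - z - z * u = z * (expR u - (1 + u)) by ring.
have [->|u0] := eqVneq u 0; first by
  rewrite expR0 mulr1 addr0 subrr mulr0 eqxx; split; rewrite ?lexx ?eqxx.
have gap := expR_gt1Dx u0.
apply/leifP; rewrite ifN; first by rewrite mulr_gt0 // subr_gt0.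
by rewrite -[X in _ == X]mulr1 (inj_eq (mulfI (lt0r_neq0 z0))) -expR0
  (inj_eq (@expR_inj R)).
Qed.

Section Existence.
Variables (R : realType) (K C : nat) (A : 'I_K -> nat).
Hypothesis A_gt0 : forall k, (0 < A k)%N.
Local Notation X := (state C A).
Implicit Types (n : X) (k : 'I_K) (r : 'I_K -> R).

Lemma mean_ge0 k (y : {ffun X -> R}) : (forall n, 0 <= y n) -> 0 <= mean k y.
Proof. by move=> y_ge0; apply: sumr_ge0 => n _; rewrite mulr_ge0. Qed.

Lemma mean_leC k (y : {ffun X -> R}) : is_distr y -> mean k y <= C%:R.
Proof.
move=> [y_ge0 y1]; have -> : C%:R = \sum_n C%:R * y n by rewrite -mulr_sumr y1 mulr1.
apply: ler_sum => n _.
by apply: ler_wpM2r => //; rewrite ler_nat -ltnS ltn_ord.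
Qed.

(** In the coordinates [ln (r k)] the function [ln Z] is convex, with gradient
   the vector of means. The ratio [weight r' n / weight r n] is
   [expR (\sum_k n k * (ln (r' k) - ln (r k)))], so Jensen for the exponential
   under [nu r] gives the tangent inequality without any differentiation. *)
Lemma ln_Z_tangent r r' : (forall k, 0 < r k) -> (forall k, 0 < r' k) ->
  \sum_k mean k (nu C A r) * (ln (r' k) - ln (r k))
  <= ln (Z C A r') - ln (Z C A r).
Proof.
move=> r_gt0 r'_gt0; set t := \sum_k _.
have [r_ge0 r'_ge0] : (forall k, 0 <= r k) /\ (forall k, 0 <= r' k).
  by split=> k; apply: ltW.
have [Z0 Z'0] := (Z_gt0 C A_gt0 r_ge0, Z_gt0 C A_gt0 r'_ge0).
pose s n := \sum_k (n k)%:R * (ln (r' k) - ln (r k)).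
have weight' n : weight r' n = weight r n * expR (s n).
  rewrite expR_sum -big_split; apply: eq_bigr => k _ /=.
  rewrite expRM_natl expRB !lnK ?posrE // expr_div_n mulrAC mulrCA divff ?mulr1 //.
  by rewrite gt_eqF ?exprn_gt0.
have tE : t = \sum_n nu C A r n * s n.
  under [RHS]eq_bigr do rewrite mulr_sumr.
  rewrite exchange_big; apply: eq_bigr => k _; rewrite mulr_suml.
  by apply: eq_bigr => n _; ring.
have [nu_ge0 nu1] := nu_distr C A_gt0 r_ge0.
rewrite -ln_div ?posrE // -[t]expRK ler_ln ?posrE ?expR_gt0 ?divr_gt0 //.
rewrite tE; apply: le_trans (expR_jensen s nu_ge0 nu1) _.
rewrite le_eqVlt; apply/orP; left; apply/eqP.
rewrite /Z mulrC mulr_sumr; apply: eq_bigr => n _.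
by rewrite ffunE -mulrA weight'.
Qed.

Variables b c : 'I_K -> R.
Hypotheses (b_gt0 : forall k, 0 < b k) (c_gt0 : forall k, 0 < c k).

(** The equation [b k * r k = c k + mean k (nu r)] solved for its left-hand
   side: the fixed points of [update] are the vectors sought. *)
Definition update r k := (c k + mean k (nu C A r)) / b k.
(** Its partial derivatives are [b k - (c k + mean k (nu r)) / r k], so that its
   critical points with positive coordinates are the fixed points of [update]. *)
Definition potential r := \sum_k (b k * r k - c k * ln (r k)) - ln (Z C A r).
Let lo k := c k / b k.
Let hi k := (c k + C%:R) / b k.

Let lo_gt0 k : 0 < lo k. Proof. by rewrite divr_gt0. Qed.

(** A mean number of customers lies between [0] and [C], so [update] sends
   every positive vector into one fixed box, bounded away from [0]. *)
Lemma update_box r k : (forall k, 0 < r k) -> lo k <= update r k <= hi k.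
Proof.
move=> r_gt0; have r_ge0 l : 0 <= r l by rewrite ltW.
have nuP := nu_distr C A_gt0 r_ge0; have [nu_ge0 _] := nuP.
by rewrite /update !ler_pM2r ?invr_gt0 // lerDl lerD2l mean_ge0 ?mean_leC.
Qed.

(** Replacing [ln Z] by its tangent at [r] turns [potential] into an upper bound
   with separated variables, which [update r] minimises; the sum on the right
   is the resulting decrease. *)
Lemma potential_update r : (forall k, 0 < r k) ->
  potential (update r) <= potential r - \sum_k b k *
    (r k - update r k - update r k * (ln (r k) - ln (update r k))).
Proof.
move=> r_gt0; have Tr_gt0 k : 0 < update r k.
  by apply: lt_le_trans (lo_gt0 k) _; have /andP[] := update_box k r_gt0.
have := ln_Z_tangent r_gt0 Tr_gt0; rewrite /potential.
suff -> : \sum_k mean k (nu C A r) * (ln (update r k) - ln (r k)) =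
   \sum_k (b k * update r k - c k * ln (update r k)) - \sum_k (b k * r k - c k * ln (r k))
   + \sum_k b k * (r k - update r k - update r k * (ln (r k) - ln (update r k)))
  by lra.
rewrite -sumrB -big_split; apply: eq_bigr => k _ /=.
have -> : mean k (nu C A r) = b k * update r k - c k.
  by rewrite mulrC divfK ?gt_eqF // addrC addKr.
ring.
Qed.

Local Open Scope classical_set_scope.

Lemma potential_cvg (U : Type) (F : set_system U) (f : U -> 'I_K -> R) r :
  Filter F -> (forall k, 0 < r k) -> (forall k, f x k @[x --> F] --> r k) ->
  potential (f x) @[x --> F] --> potential r.
Proof.
move=> FF r_gt0 f_r.
have lnC k : ln (f x k) @[x --> F] --> ln (r k).
  exact: cvg_comp (f_r k) (continuous_ln (r_gt0 k)).
have ZC : Z C A (f x) @[x --> F] --> Z C A r.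
  apply: cvg_big => [|n _]; first exact: add_continuous.
  apply: cvg_big => [|k _]; first exact: mul_continuous.
  apply: cvgMr_tmp; exact: cvg_comp (f_r k) (@exprn_continuous _ _ _).
apply: cvgB; last first.
  apply: cvg_comp ZC _; apply: continuous_ln; apply: Z_gt0 => // k.
  exact: ltW.
apply: cvg_big => [|k _]; first exact: add_continuous.
by apply: cvgB; apply: cvgMl_tmp.
Qed.

(** A minimiser [v] of [potential] over the box exists by compactness. The box
   contains [update v], so the decrease from [v] to [update v] vanishes, and
   its equality case gives [v = update v]. *)
Lemma fixed_point_exists :
  exists2 r, forall k, 0 < r k & forall k, b k * r k = c k + mean k (nu C A r).
Proof.
pose box := [set v : 'rV[R]_K | forall k, `[lo k, hi k] (v ord0 k)].
have boxP v : box v <-> forall k, lo k <= v ord0 k <= hi k.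
  by split=> H k; have := H k; rewrite /= in_itv.
have box_gt0 v : box v -> forall k, 0 < v ord0 k.
  by move=> /boxP H k; apply: lt_le_trans (lo_gt0 k) _; have /andP[] := H k.
have box0 : box !=set0.
  exists (\row_k lo k); apply/boxP => k; rewrite mxE lexx /=.
  by rewrite ler_pM2r ?invr_gt0 // lerDl.
have boxC : compact box.
  by apply: (@rV_compact R K (fun k => `[lo k, hi k])) => k; apply: segment_compact.
have phiC : {within box, continuous (fun v : 'rV[R]_K => potential (v ord0))}.
  apply: continuous_in_subspaceT => v; rewrite inE => /box_gt0.
  move=> v_gt0; apply: (potential_cvg (nbhs_filter v) v_gt0) => k.
  exact: coord_continuous.
have [v] := EVT_min_rV box0 boxC phiC.
rewrite inE => /box_gt0 v_gt0 vmin.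
exists (v ord0) => // k.
have Tv_gt0 l : 0 < update (v ord0) l.
  by apply: lt_le_trans (lo_gt0 l) _; have /andP[] := update_box l v_gt0.
(* [update] acts on functions, whereas the compact box consists of row vectors. *)
pose w : 'rV[R]_K := \row_k update (v ord0) k.
have wE : w ord0 = update (v ord0) by apply/funext => l; rewrite mxE.
have /vmin : w \in box by rewrite inE; apply/boxP => l; rewrite wE update_box.
rewrite wE => /le_trans/(_ (potential_update v_gt0)).
set G := \sum_l _ => le_phi.
have gap l := entropy_gap (v_gt0 l) (Tv_gt0 l).
have term_ge0 l : 0 <= b l * (v ord0 l - update (v ord0) l
    - update (v ord0) l * (ln (v ord0 l) - ln (update (v ord0) l))).
  by apply: mulr_ge0; [exact: ltW|exact: (gap l).1].
have G0 : G = 0.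
  apply/eqP; rewrite eq_le; apply/andP; split; last first.
    by apply: sumr_ge0 => l _; exact: term_ge0.
  by move: le_phi; rewrite lerDl oppr_ge0.
have /eqP := psumr_eq0P (fun l _ => term_ge0 l) G0 (i := k) isT.
rewrite mulf_eq0 gt_eqF //= eq_sym (gap k).2 => /eqP e.
by rewrite {1}e mulrC divfK ?gt_eqF.
Qed.

End Existence.

Theorem proposition1 (R : realType) (K C : nat) (A : 'I_K -> nat)
    (lambda gamma mu : 'I_K -> R)
    (hK : (1 <= K)%N) (hC : (1 <= C)%N) (hA : forall k, (0 < A k)%N)
    (hlambda : forall k, 0 < lambda k) (hgamma : forall k, 0 < gamma k)
    (hmu : forall k, 0 <= mu k) :
  (forall y : {ffun state C A -> R},
     equilibrium lambda gamma mu y <->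
     exists rho : 'I_K -> R,
       [/\ forall k, 0 <= rho k,
           rho_system C A lambda gamma mu rho
         & y = nu C A rho])
  /\ (exists y : {ffun state C A -> R}, equilibrium lambda gamma mu y).
Proof.
split=> [y|].
  split; first exact: equilibrium_nu.
  by move=> [rho [rho_ge0 rhoP ->]]; apply: nu_equilibrium.
(* Dividing the equations by [gamma k] leaves the mean, a logarithmic derivative
   of [Z], with the same coefficient [1] for all [k]. *)
pose b k := (gamma k + mu k) / gamma k.
pose c k := lambda k / gamma k.
have b_gt0 k : 0 < b k by rewrite divr_gt0 // ltr_pwDl.
have c_gt0 k : 0 < c k by rewrite divr_gt0.
have [rho rho_gt0 rhoE] := fixed_point_exists C hA b_gt0 c_gt0.
have rho_ge0 k : 0 <= rho k by exact: ltW.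
exists (nu C A rho); apply: nu_equilibrium => //; apply/rho_systemP => // k.
have gamma0 : gamma k != 0 by rewrite gt_eqF.
have := rhoE k; rewrite /b /c => /(congr1 ( *%R (gamma k))) e.
transitivity (gamma k * (lambda k / gamma k + mean k (nu C A rho))).
  by field.
by rewrite -e; field.
Qed.
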